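(* Let $\mathcal{G}=(\mathcal{E},\mathcal{I},\Theta)$ be a GDatalog[$\Delta$] program and let $I$ be an input instance for $\mathcal{G}$. There exists a unique probability measure space $(\Omega,\mathcal{F},\pi)$ (denoted $\mu_{\mathcal{G},I}$) that satisfies all of the following: (i) $\Omega=\Omega_{\mathcal{G}}(I)$, the set of all possible outcomes of $I$ w.r.t. $\mathcal{G}$; (ii) $\mathcal{F}$ is the $\sigma$-algebra over $\Omega$ generated by the sets of the form $\Omega_{\mathcal{G}}^{F\subseteq}(I)$, where $F$ is a finite set of facts; (iii) $\pi(\Omega_{\mathcal{G}}^{F\subseteq}(I))=\mathbf{P}(F)$ for every derivation set $F$ (w.r.t. $I$). Moreover, if $J$ is a finite possible outcome, then $\pi(\{J\})=\mathbf{P}(J)$.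
   Context: Schemas, facts, instances. A schema is a collection of relation symbols $R$, each with an arity $\mathrm{arity}(R)\in\mathbb{N}$. A fact over a schema is an expression $R(c_1,\dots,c_n)$ with $R$ an $n$-ary symbol of the schema and $c_1,\dots,c_n\in\mathbb{R}$. An instance is a finite set of facts. An atom is $R(t_1,\dots,t_n)$ where each $t_i$ is a constant (real number) or a variable. Distributions. A parameterized numerical (discrete) distribution is a function $\delta:\Omega_\delta\times\mathbb{R}^k\to[0,1]$ with $\Omega_\delta\subseteq\mathbb{R}$ finite or countably infinite, such that $\sum_{o\in\Omega_\delta}\delta(o,\mathbf{p})=1$ for all $\mathbf{p}\in\mathbb{R}^k$; $k$ is denoted $\mathrm{pardim}(\delta)$. Write $\delta(o|\mathbf{p})$ for $\delta(o,\mathbf{p})$, and put $\delta(b|\mathbf{p})=0$ for $b\in\mathbb{R}\setminus\Omega_\delta$. GDatalog[$\Delta$]. Let $\Delta$ be a finite set of parameterized numerical distributions. A $\Delta$-term is $\delta[p_1,\dots,p_k]$ with $\delta\in\Delta$, $k=\mathrm{pardim}(\delta)$, each $p_i$ a variable or constant. A $\Delta$-atom is $R(t_1,\dots,t_n)$ where exactly one $t_i$ is a $\Delta$-term and all other $t_j$ are constants or variables. A GDatalog[$\Delta$] program is $\mathcal{G}=(\mathcal{E},\mathcal{I},\Theta)$ with $\mathcal{E},\mathcal{I}$ disjoint schemas and $\Theta$ a finite set of rules $\forall\mathbf{x}(\psi(\mathbf{x})\leftarrow\varphi(\mathbf{x}))$, where $\varphi$ is a conjunction of atoms over $\mathcal{E}\cup\mathcal{I}$,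 $\psi$ is an atom or a $\Delta$-atom over $\mathcal{I}$, and every variable of $\mathbf{x}$ occurs in $\varphi$. An input instance for $\mathcal{G}$ is an instance over $\mathcal{E}$. Associated program $\widehat{\mathcal{G}}=(\mathcal{E},\mathcal{I}^\Delta,\Theta^\Delta)$. $\mathcal{I}^\Delta$ extends $\mathcal{I}$ with a new ''distributional'' relation symbol $R^\delta_i$ of arity $\mathrm{arity}(R)+\mathrm{pardim}(\delta)$ whenever some rule of $\Theta$ contains a $\Delta$-atom over $R$ with a term $\delta[\dots]$ in position $i$. $\Theta^\Delta$ consists of: (a) all rules of $\Theta$ without $\Delta$-terms; (b) the rule $\exists y\,R^\delta_i(\mathbf{t},y,\mathbf{t}',\mathbf{p})\leftarrow\varphi(\mathbf{x})$ for every rule $R(\mathbf{t},\delta[\mathbf{p}],\mathbf{t}')\leftarrow\varphi(\mathbf{x})$ of $\Theta$ with $\delta[\mathbf{p}]$ in position $i$ ($y$ is then in position $i$); (c) the rule $R(\mathbf{x})\leftarrow R^\delta_i(\mathbf{x},\mathbf{p})$ for every distributional symbol $R^\delta_i$. Possible outcomes. A solution of $I$ w.r.t. $\widehat{\mathcal{G}}$ is a possibly infinite set $J$ of facts over $\mathcal{E}\cup\mathcal{I}^\Delta$ with $I\subseteq J$ satisfying all rules of $\Theta^\Delta$ as first-order sentences; it is minimal if no proper subset of it is a solution. A possible outcome of $I$ w.r.t. $\mathcal{G}$ is a minimal solution $J$ such that $\delta(b|\mathbf{p})>0$ for every distributional fact $R^\delta_i(\mathbf{a},b,\mathbf{c},\mathbf{p})\in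 J$ with $b$ in position $i$. $\Omega_{\mathcal{G}}(I)$ is the set of all possible outcomes. For a set $F$ of facts (over $\mathcal{E}\cup\mathcal{I}^\Delta$), $\Omega_{\mathcal{G}}^{F\subseteq}(I)=\{J\in\Omega_{\mathcal{G}}(I)\mid F\subseteq J\}$. Weights. The weight of a distributional fact $R^\delta_i(a_1,\dots,a_n,\mathbf{p})$ is $\delta(a_i|\mathbf{p})$; every other fact has weight $1$. For a finite set $F$ of facts, $\mathbf{P}(F)=\prod_{f\in F}\mathrm{weight}(f)$. Derivation sets. A sequence $(f_1,\dots,f_n)$ of facts is a derivation (w.r.t. $I$) if for each $i$ there are a rule of $\Theta^\Delta$ and an assignment $\mathbf{a}$ of reals to its universally quantified variables such that in $I\cup\{f_1,\dots,f_{i-1}\}$ the premise holds for $\mathbf{a}$ but the conclusion does not, and $f_i$ is the resulting conclusion fact; for a rule with conclusion $\exists y\,R^\delta_i(\mathbf{t},y,\mathbf{t}',\mathbf{p})$, ''does not hold'' means that no value of $y$ works, and $f_i$ is obtained by choosing for $y$ some value $b$ with $\delta(b|\mathbf{p})>0$. Then $\{f_1,\dots,f_n\}$ is called a derivation set. A probability measure space is a triple $(\Omega,\mathcal{F},\pi)$ with $\mathcal{F}$ a $\sigma$-algebra over $\Omega$ and $\pi$ a countably additive probability measure on $\mathcal{F}$. *)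

(* Defs.v *)
From HB Require Import structures.
From mathcomp Require Import all_boot all_order all_algebra.
From mathcomp Require Import all_classical all_reals all_analysis.

Set Implicit Arguments.
Unset Strict Implicit.
Unset Printing Implicit Defensive.

Import Order.TTheory GRing.Theory Num.Theory.

Local Open Scope classical_set_scope.
Local Open Scope ring_scope.

(* [dprob d o p] is delta(o|p); the function delta on Omega_delta x R^k is
   extended by 0 outside Omega_delta ([dprob_out]). *)
Record pdist (R : realType) := PDist {
  pardim : nat;
  dsupp : set R;
  dprob : R -> 'rV[R]_pardim -> R;
  dsupp_countable : countable dsupp;
  dprob_range : forall o p, 0 <= dprob o p <= 1;
  dprob_out : forall o p, ~ dsupp o -> dprob o p = 0;
  dprob_sum1 : forall p, (\esum_(o in dsupp) (dprob o p)%:E = 1)%E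
}.

Definition vec_of_seq (R : realType) (k : nat) (s : seq R) : 'rV[R]_k :=
  \row_(j < k) s`_j.

Record fact (Y R : Type) := Fact { fsym : Y; fargs : seq R }.

HB.instance Definition _ (Y R : Type) := gen_eqMixin (fact Y R).
HB.instance Definition _ (Y R : Type) := gen_choiceMixin (fact Y R).

(* A schema is a set of symbols, the arities being fixed on the type [Y] of all
   symbols. *)
Definition fact_over (Y R : Type) (ar : Y -> nat) (sch : set Y) (f : fact Y R) :=
  sch (fsym f) /\ size (fargs f) = ar (fsym f).

Inductive term (R : Type) := Var of nat | Const of R.
Arguments Var {R}.

Record atom (Y R : Type) := Atom { asym : Y; aargs : seq (term R) }.

HB.instance Definition _ (Y R : Type) := gen_eqMixin (atom Y R).

Definition atom_over (Y R : Type) (ar : Y -> nat) (sch : set Y) (a : atom Y R) :=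
  sch (asym a) /\ size (aargs a) = ar (asym a).

Definition term_vars (R : Type) (t : term R) : seq nat :=
  if t is Var x then [:: x] else [::].

Definition terms_vars (R : Type) (ts : seq (term R)) : seq nat :=
  flatten (map (@term_vars R) ts).

Definition inst_term (R : Type) (v : nat -> R) (t : term R) : R :=
  match t with Var x => v x | Const c => c end.

Definition inst_atom (Y R : Type) (v : nat -> R) (a : atom Y R) : fact Y R :=
  Fact (asym a) (map (inst_term v) (aargs a)).

(* [DeltaHead r t d p t'] is the Delta-atom r(t, d[p], t'); its Delta-term is in
   position [size t], positions being counted from 0. *)
Inductive head (S : Type) (R : realType) :=
| PlainHead of atom S R
| DeltaHead (r : S) (t : seq (term R)) (d : pdist R) (p t' : seq (term R)).

Record rule (S : Type) (R : realType) :=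
  Rule { rhead : head S R; rbody : seq (atom S R) }.

Definition head_vars (S : Type) (R : realType) (h : head S R) : seq nat :=
  match h with
  | PlainHead a => terms_vars (aargs a)
  | DeltaHead _ t _ p t' => terms_vars t ++ terms_vars p ++ terms_vars t'
  end.

Definition head_wf (S : Type) (R : realType) (ar : S -> nat)
    (Delta : set (pdist R)) (idb : set S) (h : head S R) : Prop :=
  match h with
  | PlainHead a => atom_over ar idb a
  | DeltaHead r t d p t' =>
      [/\ idb r, (size t + 1 + size t')%N = ar r, Delta d
        & size p = pardim d]
  end.

Definition rule_wf (S : Type) (R : realType) (ar : S -> nat)
    (Delta : set (pdist R)) (edb idb : set S) (c : rule S R) : Prop :=
  [/\ forall a, a \in rbody c -> atom_over ar (edb `|` idb) a,
      head_wf ar Delta idb (rhead c)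
    & forall x, x \in head_vars (rhead c) ->
        exists2 a, a \in rbody c & x \in terms_vars (aargs a)].

Record program (S : Type) (R : realType) (ar : S -> nat)
    (Delta : set (pdist R)) := Program {
  edb : set S;
  idb : set S;
  rules : set (rule S R);
  edb_idb_disjoint : edb `&` idb = set0;
  rules_finite : finite_set rules;
  rules_wf : forall c, rules c -> rule_wf ar Delta edb idb c
}.

(* [Distr r d i] is the distributional symbol r^d_i. *)
Inductive xsym (S : Type) (R : realType) :=
| Orig of S
| Distr (r : S) (d : pdist R) (i : nat).
Arguments Orig {S R}.

Section AssociatedProgram.
Context (S : Type) (R : realType) (ar : S -> nat) (Delta : set (pdist R)).

Definition xar (s : xsym S R) : nat :=
  match s with Orig r => ar r | Distr r d _ => (ar r + pardim d)%N end.

Notation xfact := (fact (xsym S R) R).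

Inductive xhead :=
| XPlain of atom (xsym S R) R
(* exists y, r^d_(size t) (t, y, t', p) *)
| XExists (r : S) (t : seq (term R)) (d : pdist R) (p t' : seq (term R)).

Record xrule := XRule { xrhead : xhead; xrbody : seq (atom (xsym S R) R) }.

Definition lift_atom (a : atom S R) : atom (xsym S R) R :=
  Atom (Orig (asym a)) (aargs a).

Context (G : program ar Delta).

Definition distr_occurs (r : S) (d : pdist R) (i : nat) : Prop :=
  exists c t p t',
    [/\ rules G c, rhead c = DeltaHead r t d p t' & size t = i].

Definition xschema : set (xsym S R) := [set s |
  match s with
  | Orig r => (edb G `|` idb G) r
  | Distr r d i => distr_occurs r d i
  end].

Definition var_seq (n : nat) : seq (term R) := map Var (iota 0 n).

Inductive xrules : set xrule :=
| xrules_plain a b :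
    rules G (Rule (PlainHead a) b) ->
    xrules (XRule (XPlain (lift_atom a)) (map lift_atom b))
| xrules_sample r t d p t' b :
    rules G (Rule (DeltaHead r t d p t') b) ->
    xrules (XRule (XExists r t d p t') (map lift_atom b))
| xrules_project r d i :
    distr_occurs r d i ->
    xrules (XRule (XPlain (Atom (Orig r) (var_seq (ar r))))
                  [:: Atom (Distr r d i) (var_seq (ar r + pardim d))]).

Definition sample_fact (v : nat -> R) (r : S) (t : seq (term R)) (d : pdist R)
    (p t' : seq (term R)) (y : R) : xfact :=
  let inst := map (inst_term v) in
  Fact (Distr r d (size t)) (inst t ++ y :: inst t' ++ inst p).

Definition body_holds (K : set xfact) (v : nat -> R) (c : xrule) : Prop :=
  forall a, a \in xrbody c -> K (inst_atom v a).

Definition head_holds (K : set xfact) (v : nat -> R) (c : xrule) : Prop :=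
  match xrhead c with
  | XPlain a => K (inst_atom v a)
  | XExists r t d p t' => exists y, K (sample_fact v r t d p t' y)
  end.

Definition head_produces (v : nat -> R) (c : xrule) (f : xfact) : Prop :=
  match xrhead c with
  | XPlain a => f = inst_atom v a
  | XExists r t d p t' => exists b,
      0 < dprob b (vec_of_seq (pardim d) (map (inst_term v) p)) /\
      f = sample_fact v r t d p t' b
  end.

Definition weight (f : xfact) : R :=
  match fsym f with
  | Orig _ => 1
  | Distr r d i =>
      dprob (fargs f)`_i (vec_of_seq (pardim d) (drop (ar r) (fargs f)))
  end.

Definition PF (F : set xfact) : R := \big[*%R/1]_(f \in F) weight f.

Definition input_instance (I : set xfact) : Prop :=
  finite_set I /\ forall f, I f -> fact_over xar (Orig @` edb G) f.

Context (I : set xfact).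

Definition solution (J : set xfact) : Prop :=
  [/\ forall f, J f -> fact_over xar xschema f,
      I `<=` J
    & forall c v, xrules c -> body_holds J v c -> head_holds J v c].

Definition minimal_solution (J : set xfact) : Prop :=
  solution J /\ forall J', solution J' -> ~ (J' `<` J).

(* For a distributional fact, delta(b|p) is its weight. *)
Definition possible_outcomes : set (set xfact) := [set J |
  minimal_solution J /\
  forall r d i a, J (Fact (Distr r d i) a) -> 0 < weight (Fact (Distr r d i) a)].

Definition outcomes_with (F : set xfact) : set (set xfact) :=
  [set J | possible_outcomes J /\ F `<=` J].

Definition outcome_generators : set (set (set xfact)) := [set A |
  exists F, [/\ finite_set F, forall f, F f -> fact_over xar xschema f
              & A = outcomes_with F]].

Definition derivation_step (K : set xfact) (f : xfact) : Prop :=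
  exists c v, [/\ xrules c, body_holds K v c, ~ head_holds K v c
                & head_produces v c f].

Definition derivation (s : seq xfact) : Prop :=
  forall s1 f s2, s = s1 ++ f :: s2 -> derivation_step (I `|` [set` s1]) f.

Definition derivation_set (F : set xfact) : Prop :=
  exists2 s, derivation s & F = [set` s].

End AssociatedProgram.

(* The carrier is a set in an ambient type [T], because [measurableType] would
   require a distinguished point of the sample space, i.e. its nonemptiness.
   [sigma_algebra D] of the library does not force its members to be subsets of
   [D], hence [events_sub]. *)
Record prob_space (R : realType) (T : Type) := ProbSpace {
  sample_space : set T;
  events : set (set T);
  prob : set T -> \bar R;
  events_sigma_algebra : sigma_algebra sample_space events;
  events_sub : forall A, events A -> A `<=` sample_space;
  prob_ge0 : forall A, events A -> (0 <= prob A)%E;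
  prob_set0 : prob set0 = 0%E;
  prob_sample_space : prob sample_space = 1%E;
  prob_sigma_additive : forall A : nat -> set T,
    (forall n, events (A n)) -> trivIset setT A ->
    prob (\bigcup_n A n) = (\sum_(0 <= n <oo) prob (A n))%E
}.

(* [prob] is only meaningful on events. *)
Definition same_prob_space (R : realType) (T : Type) (M M' : prob_space R T) :=
  [/\ sample_space M = sample_space M', events M = events M'
    & forall A, events M A -> prob M A = prob M' A].

(* Main.v *)
Require Import Defs.
From HB Require Import structures.
From mathcomp Require Import all_boot all_order all_algebra.
From mathcomp Require Import all_classical all_reals all_analysis.
From mathcomp Require Import zify.

Import Order.TTheory GRing.Theory Num.Theory.

Local Open Scope classical_set_scope.
Local Open Scope ring_scope.

(* Fix in advance one value [c k] for every potential sampling event [k] and run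
   all rules to saturation, resolving existential quantifiers by [c]. The least
   fixpoint [chase c] is a minimal solution, every minimal solution arises in this
   way, and a derivation set F is contained in [chase c] if and only if [c] agrees
   with the sampling facts of F, which concern pairwise distinct events. Only
   countably many facts are reachable, so the values can be drawn independently on
   [0, 1[ with Lebesgue measure, by splitting each interval of a nested sequence
   proportionally to the weights of the next distribution. The measure of the
   theorem is the law of [chase c]: independence gives P(F) as the probability of
   F `<=` chase c.
   Uniqueness: two derivation sets contained in a common outcome have a derivation
   set as union, so the sets of outcomes containing a derivation set form, with
   the empty set, a pi-system; the other generators are countable unions of its
   members. A finite outcome is the input plus a derivation set. *)

Set Implicit Arguments.
Unset Strict Implicit.
Unset Printing Implicit Defensive.

(** * Sampling from nested intervals *)

Section NestedIntervals.
Context (R : realType) (p : nat -> nat -> R).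
Hypothesis p_ge0 : forall n m, 0 <= p n m.
Hypothesis p_sum1 : forall n, (\sum_(0 <= m <oo) (p n m)%:E = 1)%E.

Definition cut n m : R := \sum_(0 <= i < m) p n i.

Lemma cut0 n : cut n 0 = 0. Proof. by rewrite /cut big_geq. Qed.

Lemma cutS n m : cut n m.+1 = cut n m + p n m.
Proof. by rewrite /cut big_nat_recr. Qed.

Lemma cut_ge0 n m : 0 <= cut n m.
Proof. exact: sumr_ge0. Qed.

Lemma le_cut n : {homo cut n : i j / (i <= j)%N >-> i <= j}.
Proof.
move=> i j ij; rewrite /cut [leRHS](big_cat_nat _ ij)//= lerDl.
exact: sumr_ge0.
Qed.

Lemma cut_le1 n m : cut n m <= 1.
Proof.
rewrite -lee_fin -(p_sum1 n) /cut -sumEFin.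
by apply: nneseries_lim_ge => k _ _; rewrite lee_fin.
Qed.

Lemma cut_gt n x : x < 1 -> exists m, x < cut n m.
Proof.
move=> x1; apply: contrapT => /forallNP h.
have : (\sum_(0 <= m <oo) (p n m)%:E <= x%:E)%E.
  apply: lime_le; first by apply: is_cvg_nneseries => k _ _; rewrite lee_fin.
  apply: nearW => m; rewrite sumEFin lee_fin leNgt; exact/negP/h.
by rewrite p_sum1 lee_fin leNgt x1.
Qed.

(** A pair [s] encodes the interval with left end [s.1] and length [s.2]. The default 0 can only
    occur for points outside that interval. *)
Definition letter n (s : R * R) (x : R) : nat :=
  xget 0%N [set m | s.1 + s.2 * cut n m <= x < s.1 + s.2 * cut n m.+1].

Definition child n (s : R * R) m : R * R := (s.1 + s.2 * cut n m, s.2 * p n m).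

Definition seg (s : R * R) : set R := [set` `[s.1, s.1 + s.2[].

Lemma segP s x : seg s x <-> s.1 <= x < s.1 + s.2.
Proof. by rewrite /seg /= in_itv. Qed.

Lemma child_seg n s m x : seg (child n s m) x <->
  s.1 + s.2 * cut n m <= x < s.1 + s.2 * cut n m.+1.
Proof. by rewrite segP /= cutS mulrDr addrA. Qed.

Lemma child_sub n s m : 0 <= s.2 -> seg (child n s m) `<=` seg s.
Proof.
move=> s0 x /child_seg /andP[h1 h2]; apply/segP; apply/andP; split.
  by apply: le_trans h1; rewrite lerDl mulr_ge0// cut_ge0.
by apply: (lt_le_trans h2); rewrite lerD2l ler_piMr// cut_le1.
Qed.

Lemma child_inj n s m m' x : 0 <= s.2 ->
  seg (child n s m) x -> seg (child n s m') x -> m = m'.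
Proof.
move=> s0; wlog : m m' / (m <= m')%N => [H mx mx'|].
  by case/orP: (leq_total m m') => mm'; [exact: H|apply/esym/H].
rewrite leq_eqVlt => /orP[/eqP//|mm'] /child_seg/andP[_ h] /child_seg/andP[h' _].
have hh : s.1 + s.2 * cut n m.+1 <= s.1 + s.2 * cut n m'.
  by rewrite lerD2l ler_wpM2l// le_cut.
by have := lt_le_trans (le_lt_trans h' h) hh; rewrite ltxx.
Qed.

(** The partial sums [cut n m] tend to 1, so some right end exceeds [x]. The least such index is not
    0, because [cut n 0 = 0] and [s.1 <= x]; its predecessor is the letter. *)
Lemma letter_seg n s x : seg s x -> seg (child n s (letter n s x)) x.
Proof.
move=> /segP /andP[h1 h2]; have s0 : 0 < s.2.
  by rewrite -(ltrD2l s.1) addr0; exact: le_lt_trans h1 h2.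
apply/child_seg; rewrite /letter; 
apply: (@xgetPex _ 0%N [set m | s.1 + s.2 * cut n m <= x < s.1 + s.2 * cut n m.+1]).
have [|m] := @cut_gt n ((x - s.1) / s.2).
  by rewrite ltr_pdivrMr// mul1r ltrBlDl.
rewrite ltr_pdivrMr// ltrBlDl mulrC => hm.
have ex : exists m, x < s.1 + s.2 * cut n m by exists m.
case: (ex_minnP ex) => -[|k] hk kmin.
  by move: hk; rewrite cut0 mulr0 addr0 ltNge h1.
by exists k; rewrite /= hk andbT leNgt; apply/negP => /kmin; rewrite ltnn.
Qed.

(** A half-open interval that contains a point has positive length. Hence values of probability 0
    are drawn at no point at all, not merely almost nowhere. *)
Lemma letter_gt0 n s x : seg s x -> 0 < p n (letter n s x).
Proof.
move=> sx; have /segP/andP[h1 h2] := @letter_seg n s x sx.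
have /segP/andP[h3 h4] := sx.
have s0 : 0 < s.2 by rewrite -(ltrD2l s.1) addr0; exact: le_lt_trans h3 h4.
have := le_lt_trans h1 h2; rewrite ltrDl /= pmulr_rgt0//.
Qed.

Fixpoint state (x : R) n : R * R :=
  if n is n'.+1 then child n' (state x n') (letter n' (state x n') x)
  else (0, 1).

Lemma state_seg x n : `[0, 1[%classic x -> seg (state x n) x.
Proof.
move=> x01; elim: n => [|n IH]; first by rewrite /seg/= add0r.
exact: letter_seg.
Qed.

Definition sample n x := letter n (state x n) x.

(** Here [s] is an interval of stage [n], and [Q] prescribes letters at the next [k] stages, [None]
    leaving a stage free. The recursion follows the tree of intervals, so that the measure can be
    computed stage by stage. *)
Fixpoint cylinder k n s (Q : nat -> option nat) : set R :=
  if k is k'.+1 then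
    if Q n is Some m then cylinder k' n.+1 (child n s m) Q
    else \bigcup_m cylinder k' n.+1 (child n s m) Q
  else seg s.

Lemma child_ge0 n s m : 0 <= s.2 -> 0 <= (child n s m).2.
Proof. by move=> s0; rewrite mulr_ge0. Qed.

Lemma cylinder_sub k n s Q : 0 <= s.2 -> cylinder k n s Q `<=` seg s.
Proof.
elim: k n s => [|k IH] n s s0 //=.
have H m : cylinder k n.+1 (child n s m) Q `<=` seg s.
  by apply: subset_trans (@child_sub n s m s0); apply/IH/child_ge0.
by case: (Q n) => [m|]//; apply: bigcup_sub.
Qed.

Lemma cylinder_measurable k n s Q : measurable (cylinder k n s Q).
Proof.
elim: k n s => [|k IH] n s /=; first exact: measurable_itv.
case: (Q n) => [m|]//; exact: bigcup_measurable.
Qed.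

Lemma cylinder_trivIset k n s Q : 0 <= s.2 ->
  trivIset setT (fun m => cylinder k n.+1 (child n s m) Q).
Proof.
move=> s0 i j _ _ [x [xi xj]]; apply: (@child_inj n s i j x) => //.
  by apply: cylinder_sub xi; exact: child_ge0.
by apply: cylinder_sub xj; exact: child_ge0.
Qed.

Definition qweight (Q : nat -> option nat) n : R :=
  if Q n is Some m then p n m else 1.

(** A prescribed letter scales the length by its probability. A free stage is a disjoint union over
    all letters, whose factors add up to 1 by [p_sum1]. *)
Lemma cylinder_measure k n s Q : 0 <= s.2 ->
  lebesgue_measure (cylinder k n s Q) =
  (s.2 * \prod_(n <= i < n + k) qweight Q i)%:E.
Proof.
elim: k n s => [|k IH] n s s0.
  rewrite addn0 big_geq// mulr1 /= lebesgue_measure_itv /= lte_fin ltrDl.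
  case: ltP => [_|]; first by rewrite -EFinB addrAC subrr add0r.
  by move=> h; congr EFin; apply/eqP; rewrite eq_le s0 h.
rewrite big_ltn; last by rewrite addnS ltnS leq_addr.
rewrite -addSnnS /=; move: (IH n.+1) => {}IH; rewrite {1}/qweight.
case: (Q n) => [m|]; first by rewrite IH ?child_ge0//= mulrA.
rewrite measure_bigcup/=; last 2 first.
- by move=> *; exact: cylinder_measurable.
- exact: cylinder_trivIset.
rewrite -[RHS]mule1 -(p_sum1 n) -nneseriesZl; last first.
  by move=> i _; rewrite lee_fin.
rewrite nneseries_esum; last by move=> m _; exact: measure_ge0.
rewrite nneseries_esumT; last first.
  move=> m; rewrite -EFinM lee_fin !mulr_ge0//; apply: prodr_ge0 => i _.
  by rewrite /qweight; case: (Q i).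
rewrite set_mem_set; apply: eq_esum => m _; rewrite IH ?child_ge0//= -EFinM; congr EFin.
by rewrite mul1r mulrAC.
Qed.

Definition obeys (Q : nat -> option nat) x n : Prop :=
  forall m, Q n = Some m -> sample n x = m.

(** Siblings are disjoint, so lying in a cylinder over the child [m] forces the letter of [x] at
    that stage to be [m]. *)
Lemma cylinderP k n x Q : `[0, 1[%classic x ->
  cylinder k n (state x n) Q x <->
  forall i, (n <= i < n + k)%N -> obeys Q x i.
Proof.
move=> x01; have sge0 i : 0 <= (state x i).2.
  by elim: i => //= i IH; rewrite mulr_ge0.
elim: k n => [|k IH] n.
  split=> [_ i|_]; last exact: state_seg.
  by rewrite addn0 => /andP[/leq_ltn_trans/[apply]]; rewrite ltnn.
have Hch m : cylinder k n.+1 (child n (state x n) m) Q x <->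
    sample n x = m /\ forall i, (n.+1 <= i < n.+1 + k)%N -> obeys Q x i.
  split=> [h|[<- h]]; last by apply: (IH n.+1).2.
  suff e : sample n x = m.
    by split=> //; apply: (IH n.+1).1; rewrite /= -/(sample n x) e.
  apply: (@child_inj n (state x n) _ _ x) => //; first exact/letter_seg/state_seg.
  by apply: cylinder_sub h; exact: child_ge0.
have -> : (forall i, (n <= i < n + k.+1)%N -> obeys Q x i) <->
   obeys Q x n /\ forall i, (n.+1 <= i < n.+1 + k)%N -> obeys Q x i.
  rewrite addnS -addSn; split=> [h|[h1 h2] i].
    split; first by apply: h; rewrite leqnn addSn ltnS leq_addr.
    by move=> i /andP[/ltnW h1 h2]; apply: h; rewrite h1 h2.
  case/andP; rewrite leq_eqVlt => /orP[/eqP <-//|h3 h4]; apply: h2.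
  by rewrite h3 h4.
rewrite /= /obeys; case: (Q n) => [m|].
  rewrite Hch; split=> -[h1 h2]; split=> //; first by move=> _ [<-].
  exact: h1.
split=> [[m _ /Hch[_ h]]//|[_ h]].
by exists (sample n x) => //; apply/Hch.
Qed.

Lemma sample_gt0 n x : `[0, 1[%classic x -> 0 < p n (sample n x).
Proof. by move=> x01; exact/letter_gt0/state_seg. Qed.

Lemma sample_cylinder N Q :
  `[0, 1[%classic `&` [set x | forall i, (i < N)%N -> obeys Q x i] =
  cylinder N 0 (0, 1) Q.
Proof.
apply/seteqP; split=> [x [x01 h]|x h].
  by apply: (cylinderP N 0 Q x01).2 => i /= iN; exact: h.
have x01 : `[0, 1[%classic x.
  by move: (@cylinder_sub N 0%N (0, 1) Q ler01 x h); rewrite /seg/= add0r.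
by split=> // i iN; apply: (cylinderP N 0 Q x01).1.
Qed.

End NestedIntervals.

(** * Independent draws from countably many discrete distributions *)

(** Transports a discrete distribution to the natural numbers. The components of [c] are the
    transported probabilities, the decoding and the encoding; numbers that encode nothing get
    probability 0. *)
Lemma discrete_coding (R : realType) (O : choiceType) (A : set O) (q : O -> R) :
  countable A -> (forall o, 0 <= q o) -> (\esum_(o in A) (q o)%:E = 1)%E ->
  exists c : (nat -> R) * (nat -> O) * (O -> nat),
    [/\ forall m, 0 <= c.1.1 m,
        (\sum_(0 <= m <oo) (c.1.1 m)%:E = 1)%E,
        forall m, 0 < c.1.1 m ->
          [/\ A (c.1.2 m), q (c.1.2 m) = c.1.1 m & c.2 (c.1.2 m) = m]
      & forall o, A o -> c.1.2 (c.2 o) = o /\ c.1.1 (c.2 o) = q o].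
Proof.
move=> /countable_injP[e einj] q0 q1.
(* An empty support would have sum 0. The point [z0] is the default value of the decoding. *)
have [z0 Ao0] : A !=set0.
  apply/set0P/eqP => A0; move: q1; rewrite A0 esum_set0 => -[] /esym/eqP.
  by rewrite oner_eq0.
pose dec m := xget z0 [set o | A o /\ e o = m].
pose p m := if m \in e @` A then q (dec m) else 0.
have decP m : m \in e @` A -> A (dec m) /\ e (dec m) = m.
  rewrite inE => -[y Ay <-].
  by apply: (@xgetPex _ z0 [set y' | A y' /\ e y' = e y]); exists y.
have edec o : A o -> dec (e o) = o.
  move=> Ao; have [|Ad ed] := decP (e o); first by rewrite inE; exists o.
  by apply: einj; rewrite ?inE.
have pe o : A o -> p (e o) = q o.
  by move=> Ao; rewrite /p edec// ifT// inE; exists o.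
have p0 m : 0 <= p m by rewrite /p; case: ifP.
exists (p, dec, e); split => //=.
- rewrite nneseries_esumT; last by move=> m; rewrite lee_fin.
  rewrite -q1 -(_ : \esum_(m in e @` A) (p m)%:E = \esum_(o in A) (q o)%:E)%E.
    rewrite [RHS]esum_mkcond; apply: eq_esum => m _; case: ifP => // h.
    by rewrite /p h.
  rewrite (@reindex_esum _ _ _ A _ e)//; first by apply: eq_esum => o /pe ->.
  by split.
- move=> m; rewrite /p; case: ifP => [/decP[? ?]|]; last by rewrite ltxx.
  by [].
- by move=> o Ao; rewrite edec// pe.
Qed.

(** Stage number [idx k] of the nested intervals draws the value of the key [k]. Prescribing the
    values of finitely many keys then describes a cylinder, whose measure is a product. *)
Lemma independent_samples (R : realType) (T : choiceType) (O : choiceType)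
    (K : set T) (A : T -> set O) (q : T -> O -> R) (o0 : O) :
  countable K -> (forall k, countable (A k)) -> (forall k o, 0 <= q k o) ->
  (forall k, \esum_(o in A k) (q k o)%:E = 1)%E ->
  exists Y : R -> T -> O,
    (forall x k, `[0, 1[%classic x -> K k -> A k (Y x k) /\ 0 < q k (Y x k)) /\
    forall (s : seq T) (o : T -> O), uniq s ->
      (forall k, k \in s -> K k /\ A k (o k)) ->
      let E := `[0, 1[%classic `&` [set x | forall k, k \in s -> Y x k = o k] in
      measurable E /\ lebesgue_measure E = (\prod_(k <- s) q k (o k))%:E.
Proof.
move=> cK cA q0 q1.
have [K0|/set0P[k0 Kk0]] := eqVneq K set0.
  exists (fun _ _ => o0); split => [x k _|s o _ sK E]; first by rewrite K0.
  case: s @E sK => [|k s] /= sK; last by have [] := sK k (mem_head _ _); rewrite K0.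
  rewrite (_ : _ `&` _ = `[0, 1[%classic); last by apply/setIidPl.
  split; first exact: measurable_itv.
  by rewrite lebesgue_measure_itv /= lte_fin ltr01 big_nil sube0.
have /choice[c cP] k := @discrete_coding R O _ _ (cA k) (q0 k) (q1 k).
have [idx idx_inj] := elimT (countable_injP _) cK.
(* Stages that number no key repeat the distribution of [k0]; no key of [K] reads their letters. *)
pose kn n := xget k0 [set k | K k /\ idx k = n].
have knK k : K k -> kn (idx k) = k.
  move=> Kk; have [] : K (kn (idx k)) /\ idx (kn (idx k)) = idx k.
    by apply: (@xgetPex _ k0 [set k' | K k' /\ idx k' = idx k]); exists k.
  by move=> ? ?; apply: idx_inj; rewrite ?inE.
pose P n := (c (kn n)).1.1.
have P0 n m : 0 <= P n m by case: (cP (kn n)) => h _ _ _; exact: h.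
have P1 n : (\sum_(0 <= m <oo) (P n m)%:E = 1)%E by case: (cP (kn n)).
pose X := sample P.
have Xgt0 n x : `[0, 1[%classic x -> 0 < P n (X n x) by exact: sample_gt0.
exists (fun x k => (c k).1.2 (X (idx k) x)); split => [x k x01 Kk|s o us sK E].
  have := Xgt0 (idx k) x x01; rewrite /P knK// => h.
  by case: (cP k) => _ _ /(_ _ h)[? -> _] _.
pose ms := map idx s.
have ums : uniq ms.
  rewrite map_inj_in_uniq// => i j /sK[Ki _] /sK[Kj _].
  by apply: idx_inj; rewrite inE.
(* Only the stages of the keys in [s] are constrained, and [N] is chosen beyond all of them. *)
pose Q n := if n \in ms then Some ((c (kn n)).2 (o (kn n))) else None.
pose N := (\max_(k <- s) idx k).+1.
have ltN k : k \in s -> (idx k < N)%N.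
  by move=> ks; rewrite ltnS; apply: (@leq_bigmax_seq _ s xpredT idx).
have -> : E = cylinder P N 0 (0, 1) Q.
  rewrite -sample_cylinder//; apply/seteqP; split=> x [x01 h]; split => //.
  - move=> i iN m; rewrite /Q; case: ifP => // /mapP[k ks ->] [<-].
    have [Kk Ak] := sK k ks; rewrite knK// -h//.
    have := Xgt0 (idx k) x x01; rewrite /P knK// => h'.
    by case: (cP k) => _ _ /(_ _ h')[_ _ ->] _.
  - move=> k ks; have [Kk Ak] := sK k ks.
    have := h (idx k) (ltN k ks); rewrite /obeys /Q map_f// knK// => /(_ _ erefl).
    by rewrite -/X => ->; case: (cP k) => _ _ _ /(_ _ Ak)[].
split; first exact: cylinder_measurable.
rewrite cylinder_measure//= mul1r add0n; congr EFin.
rewrite (eq_bigr (fun i =>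
  if i \in ms then P i ((c (kn i)).2 (o (kn i))) else 1)); last first.
  by move=> i _; rewrite /qweight /Q; case: ifP.
rewrite -big_mkcond -big_filter (perm_big ms); last first.
  apply: uniq_perm => //; first exact/filter_uniq/iota_uniq.
  move=> i; rewrite mem_filter mem_index_iota leq0n /=.
  by apply/andb_idr => /mapP[k ks ->]; exact: ltN.
rewrite big_map; apply: eq_big_seq => k ks; have [Kk Ak] := sK k ks.
by rewrite /P knK//; case: (cP k) => _ _ _ /(_ _ Ak)[].
Qed.

(** * The chase with a fixed choice function *)

Section Chase.
Context (R : realType) (S : Type) (ar : S -> nat) (Delta : set (pdist R)).
Context (G : program ar Delta) (I : set (fact (xsym S R) R)).
Hypothesis hI : input_instance G I.

Notation xfact := (fact (xsym S R) R).
Notation xar := (@xar S R ar).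

Definition dfact r (d : pdist R) a y b : xfact :=
  Fact (Distr r d (size a)) (a ++ y :: b).

Lemma sample_factE v r t d p t' y : sample_fact v r t d p t' y =
  dfact r d (map (inst_term v) t) y (map (inst_term v) t' ++ map (inst_term v) p).
Proof. by rewrite /dfact size_map. Qed.

(** The symbol records the position [size a], so both argument lists are cut at the same place. *)
Lemma dfact_inj r d a y b r' d' a' y' b' :
  dfact r d a y b = dfact r' d' a' y' b' ->
  [/\ r = r', d = d', a = a', y = y' & b = b'].
Proof.
move=> [-> -> sa /eqP]; rewrite eqseq_cat// eqseq_cons.
by move=> /and3P[/eqP -> /eqP -> /eqP ->].
Qed.

(* The least set of facts containing the input and closed under the rules when
   the existential quantifiers are resolved by [c]; a sampling rule is identified
   by its conclusion with 0 in place of the sampled value. *)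
Inductive chase (c : xfact -> R) : set xfact :=
| chase_input f : I f -> chase c f
| chase_plain a b v : xrules G (XRule (XPlain a) b) ->
    (forall e, e \in b -> chase c (inst_atom v e)) -> chase c (inst_atom v a)
| chase_sample r t d p t' b v : xrules G (XRule (XExists r t d p t') b) ->
    (forall e, e \in b -> chase c (inst_atom v e)) ->
    chase c (sample_fact v r t d p t' (c (sample_fact v r t d p t' 0))).

Lemma input_orig f : I f -> exists r, Defs.fsym f = Orig r.
Proof. by move=> /(proj2 hI)[[r _ <-] _]; exists r. Qed.

Lemma plain_orig a b : xrules G (XRule (XPlain a) b) -> exists r, asym a = Orig r.
Proof.
move e : (XRule _ _) => c h; case: h e => //.
  by move=> a' b' _ [-> _]; exists (asym a').
by move=> r d i _ [-> _]; exists r.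
Qed.

Lemma inst_atom_neq_dfact a b v r d l y l' :
  xrules G (XRule (XPlain a) b) -> inst_atom v a <> dfact r d l y l'.
Proof. by move=> /plain_orig[s e] /(congr1 (@Defs.fsym _ _)) /=; rewrite e. Qed.

(** Input facts and conclusions of plain rules carry original symbols, so only [chase_sample] can
    yield a distributional fact, with the value dictated by [c]. *)
Lemma chase_dfact c r d a y b :
  chase c (dfact r d a y b) -> y = c (dfact r d a 0 b).
Proof.
move e : (dfact _ _ _ _ _) => f h; case: h e.
- by move=> g /input_orig[s es] eg; move: es; rewrite -eg.
- by move=> a' b' v h _ /esym /(inst_atom_neq_dfact h).
- move=> r' t d' p t' b' v _ _; rewrite !sample_factE.
  by move=> /dfact_inj[-> -> -> -> ->].
Qed.

Lemma plain_over a b v : xrules G (XRule (XPlain a) b) ->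
  fact_over xar (xschema G) (inst_atom v a).
Proof.
move e : (XRule _ _) => c h; case: h e => //.
  move=> a' b' /rules_wf[_ [h1 h2] _] [-> _]; split => /=; first by right.
  by rewrite size_map.
move=> r d i [c' [t [p [t' [/rules_wf[_ h _] h1 _]]]]] [-> _].
move: h; rewrite h1 => -[h _ _ _]; split => /=; first by right.
by rewrite !size_map size_iota.
Qed.

Lemma sample_wf r t d p t' b : xrules G (XRule (XExists r t d p t') b) ->
  [/\ distr_occurs G r d (size t), (size t + 1 + size t')%N = ar r
    & size p = pardim d].
Proof.
move e : (XRule _ _) => c h; case: h e => // r0 t0 d0 p0 t0' b0 hr.
move=> [-> -> -> -> -> _]; have /rules_wf[_ [_ ? _ ?] _] := hr; split => //.
by exists (Rule (DeltaHead r0 t0 d0 p0 t0') b0), t0, p0, t0'.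
Qed.

Lemma sample_over r t d p t' b v y : xrules G (XRule (XExists r t d p t') b) ->
  fact_over xar (xschema G) (sample_fact v r t d p t' y).
Proof.
move=> /sample_wf[h sr sp]; split => //=.
by rewrite -sr -sp size_cat /= size_cat !size_map; lia.
Qed.

Lemma sample_drop r t d p t' b v y : xrules G (XRule (XExists r t d p t') b) ->
  drop (ar r) (fargs (sample_fact v r t d p t' y)) = map (inst_term v) p.
Proof.
move=> /sample_wf[_ <- _] /=; rewrite -cat_rcons catA drop_size_cat//.
by rewrite size_cat size_rcons !size_map; lia.
Qed.

Lemma weight_sample r t d p t' b v y : xrules G (XRule (XExists r t d p t') b) ->
  weight ar (sample_fact v r t d p t' y) =
  dprob y (vec_of_seq (pardim d) (map (inst_term v) p)).
Proof.
move=> h; rewrite /weight /= -/(fargs (sample_fact v r t d p t' y)).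
rewrite (sample_drop _ _ h) nth_cat size_map ltnn subnn.
by [].
Qed.

Lemma chase_over c f : chase c f -> fact_over xar (xschema G) f.
Proof.
case=> {f} [f /(proj2 hI)[[r hr e] h]|a b v h _|r t d p t' b v h _].
- by split => //; rewrite -e; left.
- exact: plain_over h.
- exact: sample_over h.
Qed.

Lemma chase_solution c : solution G I (chase c).
Proof.
split; [exact: chase_over|exact: chase_input|].
move=> [[a|r t d p t'] b] v h hb; first exact: chase_plain hb.
by exists (c (sample_fact v r t d p t' 0)); exact: chase_sample hb.
Qed.

(** Induction on the chase. At a sampling rule [J] contains a fact with some value [y]; as [J] lies
    in the chase, [chase_dfact] makes [y] the value chosen by [c]. *)
Lemma chase_sub_solution c J : solution G I J -> J `<=` chase c -> chase c `<=` J.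
Proof.
move=> [_ IJ ruleJ] Jc f; elim=> {f} [f /IJ//|a b v h _ IH|r t d p t' b v h _ IH].
  exact: (ruleJ _ v h IH).
have [y Jy] := ruleJ _ v h IH.
have := Jc _ Jy; rewrite sample_factE => /chase_dfact; rewrite -sample_factE.
by move=> <-.
Qed.

Lemma chase_minimal c : minimal_solution G I (chase c).
Proof.
split=> [|J sJ [Jc cJ]]; first exact: chase_solution.
by apply: cJ; exact: chase_sub_solution.
Qed.

Definition choice_of (J : set xfact) (k : xfact) : R :=
  xget 0 [set y | exists r d a b, k = dfact r d a 0 b /\ J (dfact r d a y b)].

Lemma choice_ofP J r d a y b : J (dfact r d a y b) ->
  J (dfact r d a (choice_of J (dfact r d a 0 b)) b).
Proof.
move=> Jy; rewrite /choice_of; set P := [set y | _].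
have [|r' [d' [a' [b' [/dfact_inj[-> -> -> _ ->]]]]]] // := @xgetPex _ 0 P.
by exists y, r, d, a, b.
Qed.

(** With choices read off from [J] the chase never leaves [J]. As it is itself a solution,
    minimality gives equality; that [J] has one value per event is a consequence and not assumed. *)
Lemma minimal_solution_chase J : minimal_solution G I J -> J = chase (choice_of J).
Proof.
move=> [[oJ IJ ruleJ] minJ].
have cJ : chase (choice_of J) `<=` J.
  move=> f; elim=> {f} [f /IJ//|a b v h _ IH|r t d p t' b v h _ IH].
    exact: (ruleJ _ v h IH).
  have [y] := ruleJ _ v h IH; rewrite !sample_factE; exact: choice_ofP.
apply/seteqP; split => //; apply: contrapT => nJ.
by apply: (minJ _ (chase_solution (choice_of J))).
Qed.

(** * A countable set containing every reachable fact *)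

Definition term_consts (ts : seq (Defs.term R)) : seq R :=
  pmap (fun t => if t is Const x then Some x else None) ts.

Lemma inst_terms_sub v ts : {subset map (inst_term v) ts
  <= map v (terms_vars ts) ++ term_consts ts}.
Proof.
elim: ts => [|[n|x] ts IH] //= y; rewrite inE => /orP[/eqP->|/IH].
- by rewrite mem_head.
- by move=> h; rewrite inE h orbT.
- by rewrite mem_cat mem_head orbT.
- by rewrite !mem_cat inE => /orP[|] ->; rewrite ?orbT.
Qed.

Lemma map_vars_sub v (ts : seq (Defs.term R)) :
  {subset map v (terms_vars ts) <= map (inst_term v) ts}.
Proof.
elim: ts => [|[n|x] ts IH] //= y; rewrite !inE.
  by move=> /orP[->//|/IH ->]; rewrite orbT.
by move=> /IH ->; rewrite orbT.
Qed.

Definition head_consts (h : Defs.head S R) : set R := match h with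
  | PlainHead a => [set` term_consts (aargs a)]
  | DeltaHead _ t d p t' => [set` term_consts (t ++ p ++ t')] `|` dsupp d
  end.

(** The values that reachable facts can contain: those of the input, the constants of rule heads and
    all values that may be sampled. The number 0 is included as the placeholder in keys. *)
Definition consts : set R :=
  [set 0] `|` \bigcup_(f in I) [set` fargs f]
  `|` \bigcup_(c in rules G) head_consts (rhead c).

Definition head_syms (h : Defs.head S R) : set (xsym S R) := match h with
  | PlainHead a => [set Orig (asym a)]
  | DeltaHead r t d _ _ => [set Orig r; Distr r d (size t)]
  end.

Definition syms : set (xsym S R) :=
  (@Defs.fsym _ _) @` I `|` \bigcup_(c in rules G) head_syms (rhead c).

Definition universe : set xfact :=
  [set f | syms (Defs.fsym f) /\ forall x, x \in fargs f -> consts x].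

Lemma countableU2 T (A B : set T) : countable A -> countable B -> countable (A `|` B).
Proof.
move=> cA cB; rewrite -bigcup2E; apply: bigcup_countable => // -[|[|n]] _ //=.
Qed.

Lemma consts_countable : countable consts.
Proof.
apply: countableU2; first apply: countableU2; first exact: countable1.
  apply: bigcup_countable => [|f _]; first exact/finite_set_countable/(proj1 hI).
  exact/finite_set_countable/finite_seq.
have tc (s : seq R) : countable [set` s] by exact/finite_set_countable/finite_seq.
apply: bigcup_countable => [|c _]; first exact/finite_set_countable/rules_finite.
case: (rhead c) => [a|r t d p t'] //=.
by apply: countableU2 => //; exact: dsupp_countable.
Qed.

Lemma syms_countable : countable syms.
Proof.
apply: countableU2.
  exact/finite_set_countable/finite_image/(proj1 hI).
apply: bigcup_countable => [|c _]; first exact/finite_set_countable/rules_finite.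
by case: (rhead c) => [a|r t d p t'] /=; apply: finite_set_countable.
Qed.

Lemma universe_countable : countable universe.
Proof.
have [e einj] := elimT (countable_injP _) consts_countable.
have [g ginj] := elimT (countable_injP _) syms_countable.
apply/countable_injP; exists (fun f => pickle (g (Defs.fsym f), map e (fargs f))).
move=> [s a] [s' a']; rewrite !inE => -[/= ss ca] [/= ss' ca'].
move=> /(pcan_inj pickleK)[/ginj -> //]; rewrite ?inE// => eaa'; congr Fact.
elim: a a' ca ca' eaa' => [|x a IH] [|x' a'] //= ca ca' [exx' eaa'].
congr cons.
  by apply: einj => //; rewrite inE; [apply: ca|apply: ca']; rewrite mem_head.
by apply: IH => // y ya; [apply: ca|apply: ca']; rewrite inE ya orbT.
Qed.

Lemma input_universe : I `<=` universe.
Proof.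
by move=> f If; split=> [|x xf]; [left; exists f|left; right; exists f].
Qed.

(** Every head variable occurs in the body, so its value already occurs in a fact of the universe;
    the other terms are constants of the head. *)
Lemma rule_terms_universe c v ts : rules G c ->
  (forall e, e \in map (@lift_atom S R) (rbody c) -> universe (inst_atom v e)) ->
  {subset terms_vars ts <= head_vars (rhead c)} ->
  [set` term_consts ts] `<=` head_consts (rhead c) ->
  forall x, x \in map (inst_term v) ts -> consts x.
Proof.
move=> hc hb hv ht x /inst_terms_sub; rewrite mem_cat => /orP[/mapP[n /hv hn ->]|xt].
  have [_ _ /(_ n hn)[a ab na]] := rules_wf hc.
  have [|_ /= hC] := hb (lift_atom a).
    by elim: (rbody c) ab => //= a' s IH; rewrite !inE => /orP[/eqP->|/IH->];
      rewrite ?eqxx ?orbT.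
  by apply: hC; apply: map_vars_sub; exact: map_f.
by right; exists c => //; exact: ht.
Qed.

Lemma plain_universe a b v : xrules G (XRule (XPlain a) b) ->
  (forall e, e \in b -> universe (inst_atom v e)) -> universe (inst_atom v a).
Proof.
move e : (XRule _ _) => c h; case: h e => //.
  move=> a' b' h [-> ->] hb; split => /=.
    by right; exists (Rule (PlainHead a') b').
  exact: (rule_terms_universe h hb).
move=> r d i [c' [t [p [t' [h h1 _]]]]] [-> ->] hb; split => /=.
  by right; exists c' => //; rewrite h1; left.
have [_ hC] := hb _ (mem_head _ _) => x hx; apply: hC => /=.
by rewrite /var_seq iotaD !map_cat mem_cat hx.
Qed.

Lemma dsupp_consts r t d p t' b : xrules G (XRule (XExists r t d p t') b) ->
  dsupp d `<=` consts.
Proof.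
move=> /sample_wf[[c [t0 [p0 [t0' [h h1 _]]]]] _ _] x xd; right; exists c => //.
by rewrite h1; right.
Qed.

Lemma sample_universe r t d p t' b v y : xrules G (XRule (XExists r t d p t') b) ->
  (forall e, e \in b -> universe (inst_atom v e)) -> consts y ->
  universe (sample_fact v r t d p t' y).
Proof.
move e : (XRule _ _) => c h; case: h e => //.
move=> r0 t0 d0 p0 t0' b0 h [-> -> -> -> -> ->] hb Cy; split => /=.
  by right; exists (Rule (DeltaHead r0 t0 d0 p0 t0') b0) => //; right.
move=> x; rewrite mem_cat inE mem_cat.
rewrite [_ || (_ || _)](_ : _ =
    (x == y) || (x \in map (inst_term v) (t0 ++ p0 ++ t0'))).
  move=> /orP[/eqP->//|]; apply: (rule_terms_universe h hb) => //=.
  by move=> n; rewrite /terms_vars !map_cat !flatten_cat.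
rewrite !map_cat !mem_cat; case: (x == y); rewrite ?orbT//=.
by rewrite [X in _ || X]orbC.
Qed.

(* The [Orig] case is junk: it only makes every fact carry a distribution. *)
Definition key_dist (k : xfact) (y : R) : R := match Defs.fsym k with
  | Orig _ => (y == 0)%:R
  | Distr r d _ => dprob y (vec_of_seq (pardim d) (drop (ar r) (fargs k)))
  end.

Definition key_supp (k : xfact) : set R := match Defs.fsym k with
  | Orig _ => [set 0]
  | Distr _ d _ => dsupp d
  end.

Lemma key_dist_ge0 k y : 0 <= key_dist k y.
Proof.
rewrite /key_dist; case: (Defs.fsym k) => [_|r d _]; first by case: eqP.
by have /andP[] := dprob_range y (vec_of_seq (pardim d) (drop (ar r) (fargs k))).
Qed.

Lemma key_dist_sum1 k : (\esum_(y in key_supp k) (key_dist k y)%:E = 1)%E.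
Proof.
rewrite /key_dist /key_supp; case: (Defs.fsym k) => [_|r d _]; last exact: dprob_sum1.
by rewrite esum_set1 ?eqxx.
Qed.

Lemma key_supp_countable k : countable (key_supp k).
Proof.
by rewrite /key_supp; case: (Defs.fsym k) => [_|r d _]; [|exact: dsupp_countable].
Qed.

Lemma key_dist_sample r t d p t' b v y : xrules G (XRule (XExists r t d p t') b) ->
  key_dist (sample_fact v r t d p t' 0) y = weight ar (sample_fact v r t d p t' y).
Proof. by move=> h; rewrite (weight_sample _ _ h) -(sample_drop v 0 h). Qed.

Lemma weight_supp r t d p t' b v y : xrules G (XRule (XExists r t d p t') b) ->
  0 < weight ar (sample_fact v r t d p t' y) -> dsupp d y.
Proof.
move=> h; rewrite (weight_sample _ _ h) => y0; apply: contrapT => nd.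
by move: y0; rewrite dprob_out ?ltxx.
Qed.

Definition positive c := forall k, universe k -> 0 < key_dist k (c k).

(** The key of a sampling event lies in the universe because 0 is in [consts]. Positivity then puts
    the chosen value in the support of the distribution, hence in [consts]. *)
Lemma chase_universe c f : positive c -> chase c f -> universe f.
Proof.
move=> c0; elim=> {f} [f /input_universe//|a b v h _ IH|r t d p t' b v h _ IH].
  exact: plain_universe IH.
apply: (sample_universe h IH); apply: (dsupp_consts h).
apply: (weight_supp h (v := v)); rewrite -(key_dist_sample _ _ h).
by apply: c0; apply: (sample_universe h IH); left; left.
Qed.

Lemma chase_outcome c : positive c -> possible_outcomes G I (chase c).
Proof.
move=> c0; split=> [|r d i a]; first exact: chase_minimal.
move e : (Fact _ _) => f h; case: h e => {f}.
- by move=> f /input_orig[s es] e; move: es; rewrite -e.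
- by move=> a' b v /plain_orig[s es] _ /(congr1 (@Defs.fsym _ _)) /=; rewrite es.
- move=> r' t d' p t' b v h hb _; rewrite -(key_dist_sample _ _ h); apply: (c0).
  apply: (sample_universe h); last by left; left.
  by move=> e /hb; exact: chase_universe.
Qed.

End Chase.

(** * Derivations *)

Section Derivations.
Context (R : realType) (S : Type) (ar : S -> nat) (Delta : set (pdist R)).
Context (G : program ar Delta) (I : set (fact (xsym S R) R)).
Hypothesis hI : input_instance G I.

Notation xfact := (fact (xsym S R) R).
Notation chase := (chase G I).
Notation derivation := (derivation G I).
Notation step := (derivation_step G).

Lemma derivation_nil : derivation [::].
Proof. by case. Qed.

Lemma derivation_rcons s f :
  derivation (rcons s f) <-> derivation s /\ step (I `|` [set` s]) f.
Proof.
split=> [h|[hs hf] s1 g s2].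
  split=> [s1 g s2 e|]; last by apply: (h s f [::]); rewrite cats1.
  by apply: (h s1 g (rcons s2 f)); rewrite e rcons_cat.
case/lastP: s2 => [|s2 g'].
  by rewrite cats1 => /rcons_inj[<- <-].
by rewrite -rcons_cons -rcons_cat => /rcons_inj[e _]; exact: hs e.
Qed.

Lemma step_new K f : step K f -> ~ K f.
Proof.
move=> [[h b] [v [hc _ nh hp]]] Kf; apply: nh; move: hp.
rewrite /head_produces /head_holds /=; case: h hc => [a|r t d p t'] _ /=.
  by move=> <-.
by move=> [y [_ e]]; exists y; rewrite -e.
Qed.

Lemma derivation_uniq s : derivation s -> uniq s.
Proof.
elim/last_ind: s => [|s f IH]//= /derivation_rcons[hs /step_new nf].
by rewrite rcons_uniq IH// andbT; apply/negP => fs; apply: nf; right.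
Qed.

Lemma derivation_head s f : derivation s -> f \in s ->
  exists a b v, [/\ xrules G (XRule a b),
    forall e, e \in b -> (I `|` [set` s]) (inst_atom v e)
    & head_produces v (XRule a b) f].
Proof.
elim/last_ind: s => [|s g IH]// /derivation_rcons[hs [[a b] [v [h1 h2 h3 h4]]]].
rewrite mem_rcons inE => /orP[/eqP->|/(IH hs)[a' [b' [v' [h1' h2' h3']]]]].
  exists a, b, v; split => // e /h2[?|es]; first by left.
  by right; rewrite /= mem_rcons inE orbC /= [_ \in _]es.
exists a', b', v'; split => // e /h2'[?|es]; first by left.
by right; rewrite /= mem_rcons inE orbC /= [_ \in _]es.
Qed.

Lemma derivation_universe s : derivation s -> [set` s] `<=` universe G I.
Proof.
elim/last_ind: s => [_ f|s g IH /derivation_rcons[hs [[h b] [v [h1 h2 h3 h4]]]] f]//=.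
rewrite mem_rcons inE => /orP[/eqP->|/(IH hs)//].
have hb e : e \in b -> universe G I (inst_atom v e).
  by move=> /h2[/input_universe//|]; exact: IH.
move: h4; rewrite /head_produces /=; case: h h1 {h2 h3} => [a|r t d p t'] h1 /=.
  by move=> ->; exact: (plain_universe h1).
move=> [y [y0 ->]]; apply: (sample_universe h1 hb); apply: (dsupp_consts I h1).
by apply: (weight_supp h1 (v := v)); rewrite (weight_sample _ _ h1).
Qed.

Lemma derivation_over s f : derivation s -> f \in s ->
  fact_over (@xar S R ar) (xschema G) f.
Proof.
move=> hs /(derivation_head hs)[h [b [v [h1 _]]]].
rewrite /head_produces /=; case: h h1 => [a|r t d p t'] h1 /=.
  by move=> ->; exact: plain_over h1.
by move=> [y [_ ->]]; exact: sample_over h1.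
Qed.

Lemma derivation_sampled s f : derivation s -> f \in s ->
  (exists r, Defs.fsym f = Orig r) \/
  exists r d a y b, [/\ f = dfact r d a y b, universe G I (dfact r d a 0 b),
    key_supp (dfact r d a 0 b) y
    & weight ar f = key_dist ar (dfact r d a 0 b) y].
Proof.
move=> hs fs; have [h [b [v [h1 h2]]]] := derivation_head hs fs.
have hb e : e \in b -> universe G I (inst_atom v e).
  by move=> /h2[/input_universe//|]; exact: derivation_universe.
rewrite /head_produces /=; case: h h1 => [a|r t d p t'] h1 /=.
  by move=> ->; left; exact: plain_orig h1.
move=> [y [y0 ->]]; right; exists r, d, (map (inst_term v) t), y,
  (map (inst_term v) t' ++ map (inst_term v) p).
have w0 : 0 < weight ar (sample_fact v r t d p t' y) by rewrite (weight_sample _ _ h1).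
rewrite -!sample_factE; split => //.
- by apply: (sample_universe h1 hb); left; left.
- exact: (weight_supp h1 w0).
- by rewrite (key_dist_sample _ _ h1).
Qed.

(** A sampling rule may fire only while no value works, so a second fact for the same event can
    never be added. *)
Lemma derivation_functional s r d a y b y' : derivation s ->
  dfact r d a y b \in s -> dfact r d a y' b \in s -> y = y'.
Proof.
have key K y1 y2 : step K (dfact r d a y1 b) -> K (dfact r d a y2 b) -> False.
  move=> [[h b'] [v [h1 _ h3 h4]]]; move: h4 h3; rewrite /head_produces /head_holds /=.
  case: h h1 => [a' h1|r' t d' p t' h1] /=.
    by move=> e; have := inst_atom_neq_dfact h1 (esym e).
  move=> [z [_]]; rewrite sample_factE => e nh.
  have [-> -> -> _ ->] := dfact_inj e => Ky.
  by apply: nh; exists y2; rewrite sample_factE.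
elim/last_ind: s => [|s g IH]// /derivation_rcons[hs hg].
rewrite !mem_rcons !inE => /orP[/eqP e|ys] /orP[/eqP e'|ys'].
- by have [] := dfact_inj (etrans e (esym e')).
- by exfalso; apply: (key _ y y'); [rewrite e; exact: hg|right].
- by exfalso; apply: (key _ y' y); [rewrite e'; exact: hg|right].
- exact: IH.
Qed.

Lemma choice_of_derivation s r d a y b : derivation s ->
  dfact r d a y b \in s -> choice_of [set` s] (dfact r d a 0 b) = y.
Proof.
move=> hs ys; apply: (derivation_functional hs _ ys).
exact: (@choice_ofP _ _ [set` s] r d a y b ys).
Qed.

(** Reduces containment to finitely many equations on [c]. Conversely, along the derivation all
    premises lie in the chase, so each conclusion does too, the sampled values agreeing with [c]. *)
Lemma derivation_sub_chase s c : derivation s ->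
  [set` s] `<=` chase c <->
  forall r d a y b, dfact r d a y b \in s -> c (dfact r d a 0 b) = y.
Proof.
move=> hs; split=> [sc r d a y b /sc /(chase_dfact hI) //|].
elim/last_ind: s hs => [_ _ f|s g IH /derivation_rcons[hs hg] hc f]//=.
move: hg => [[h b] [v [h1 h2 h3 h4]]].
have sc : [set` s] `<=` chase c.
  by apply: IH => // r d a y b' ys; apply: hc; rewrite mem_rcons inE ys orbT.
rewrite mem_rcons inE => /orP[/eqP->|/sc//].
have hb e : e \in b -> chase c (inst_atom v e).
  by move=> /h2[/chase_input|/sc]; exact.
move: h4 hc; rewrite /head_produces /=; case: h h1 {h2 h3} => [a|r t d p t'] h1 /=.
  by move=> -> _; exact: (chase_plain h1).
move=> [y [_ ->]] hc.
have := hc r d (map (inst_term v) t) y (map (inst_term v) t' ++ map (inst_term v) p).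
rewrite -!sample_factE mem_rcons mem_head => /(_ isT) <-; exact: (chase_sample h1).
Qed.

(** More facts could only block a sampling rule by supplying a value for its event. Inside [chase c]
    that value is the one in [f], so [f] would already be in [K']. *)
Lemma step_mono c K K' f : K `<=` K' -> K' `<=` chase c -> chase c f -> ~ K' f ->
  step K f -> step K' f.
Proof.
move=> KK' K'c cf nf [[h b] [v [h1 h2 h3 h4]]]; exists (XRule h b), v; split => //.
  by move=> e /h2 /KK'.
move: h4; rewrite /head_produces /head_holds /=.
case: h h1 {h2 h3} => [a|r t d p t'] h1 /=.
  by move=> <-.
move=> [y [_ e]] [y' K'y']; apply: nf.
have := K'c _ K'y'; move: cf; rewrite e !sample_factE.
by move=> /(chase_dfact hI) ey /(chase_dfact hI) ey'; rewrite ey -ey' -sample_factE.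
Qed.

(** The facts of [s2] are appended to [s1] in their order, skipping those already present;
    [step_mono] keeps each step legitimate. *)
Lemma derivationU c s1 s2 : derivation s1 -> derivation s2 ->
  [set` s1] `<=` chase c -> [set` s2] `<=` chase c ->
  exists2 s, derivation s & [set` s] = [set` s1] `|` [set` s2].
Proof.
move=> hs1 + s1c; elim/last_ind: s2 => [_ _|s2 f IH /derivation_rcons[hs2 hf] s2c].
  by exists s1 => //; rewrite set_nil setU0.
have mem_rc : [set` rcons s2 f] = f |` [set` s2].
  apply/seteqP; split => g /=; rewrite mem_rcons inE.
    by move=> /orP[/eqP|]; [left|right].
  by move=> [->|->]; rewrite ?eqxx ?orbT.
have s2c' : [set` s2] `<=` chase c by move=> g gs; apply: s2c; rewrite mem_rc; right.
have cf : chase c f by apply: s2c; rewrite mem_rc; left.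
have [s hs es] := IH hs2 s2c'.
have [fs|fs] := boolP (f \in s).
  exists s => //; rewrite mem_rc es setUCA -es; apply/esym/setUidr.
  by move=> _ ->.
exists (rcons s f); last first.
  rewrite mem_rc setUCA -es; apply/seteqP; split => g /=; rewrite mem_rcons inE.
    by move=> /orP[/eqP->|gs]; [left|right].
  by move=> [->|->]; rewrite ?eqxx ?orbT.
apply/derivation_rcons; split => //; apply: (@step_mono c (I `|` [set` s2])) => //.
- by apply: setUS; rewrite es; exact: subsetUr.
- move=> g [/chase_input|]; first exact.
  by rewrite es => -[/s1c|/s2c'].
- move=> [|]; last exact/negP.
  by move: (step_new hf) => nf If; apply: nf; left.
Qed.

Lemma derivation_cover c (F : seq xfact) :
  (forall f, f \in F -> exists s, [/\ derivation s, [set` s] `<=` chase c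
                          & (I `|` [set` s]) f]) ->
  exists s, [/\ derivation s, [set` s] `<=` chase c & [set` F] `<=` I `|` [set` s]].
Proof.
elim: F => [|f F IH] hF.
  by exists [::]; split => //; exact: derivation_nil.
have [|s1 [hs1 s1c s1f]] := hF f; first exact: mem_head.
have [|s2 [hs2 s2c s2F]] := IH; first by move=> g gF; apply: hF; rewrite inE gF orbT.
have [s hs es] := derivationU hs1 hs2 s1c s2c.
exists s; split=> //; first by rewrite es subUset.
rewrite es => g /=; rewrite inE => /orP[/eqP ->|/s2F[]].
  by case: s1f; [left|right; left].
  by left.
by right; right.
Qed.

(** Induction on the chase: one derivation covers all premises and is extended by the conclusion
    unless that is already there. Being an outcome makes the sampled value positive, as a derivation
    step demands. *)
Lemma chase_derivation c f : possible_outcomes G I (chase c) -> chase c f ->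
  exists s, [/\ derivation s, [set` s] `<=` chase c & (I `|` [set` s]) f].
Proof.
move=> [_ c0].
have add b v g h : xrules G (XRule h b) ->
    (forall e, e \in b -> chase c (inst_atom v e)) ->
    (forall e, e \in b -> exists s, [/\ derivation s, [set` s] `<=` chase c
                          & (I `|` [set` s]) (inst_atom v e)]) ->
    chase c g -> head_produces v (XRule h b) g ->
    (forall K, K `<=` chase c -> head_holds K v (XRule h b) -> K g) ->
    exists s, [/\ derivation s, [set` s] `<=` chase c & (I `|` [set` s]) g].
  move=> hr hb IH cg hp hh.
  have [|s [hs sc bs]] := @derivation_cover c (map (inst_atom v) b).
    by move=> _ /mapP[e /IH ? ->].
  have [sg|nsg] := pselect ((I `|` [set` s]) g); first by exists s.
  exists (rcons s g); split; last by right; rewrite /= mem_rcons mem_head.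
    apply/derivation_rcons; split => //; exists (XRule h b), v; split => //.
      by move=> e eb; apply: bs; exact: map_f.
    by move=> /hh hg; apply/nsg/hg => g' [/chase_input|/sc]; exact.
  by move=> g' /=; rewrite mem_rcons inE => /orP[/eqP->|/sc].
elim=> {f} [f If|a b v h hb IH|r t d p t' b v h hb IH].
- by exists [::]; split => //; [exact: derivation_nil|left].
- by apply: (add b v _ _ h) => //; exact: (chase_plain h).
- have cs : chase c (sample_fact v r t d p t' (c (sample_fact v r t d p t' 0))).
    exact: (chase_sample h).
  apply: (add b v _ _ h) => //=.
    exists (c (sample_fact v r t d p t' 0)); split => //.
    by rewrite -(weight_sample _ _ h); exact: c0.
  move=> K Kc [y Ky]; have := Kc _ Ky; rewrite !sample_factE => /(chase_dfact hI) ey.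
  by move: Ky; rewrite sample_factE {1}ey.
Qed.

End Derivations.

(** * The space of possible outcomes *)

(** An injection numbers the indices, and each number accounts for at most one set of the family. *)
Lemma sigma_algebra_countable_bigcup (T U : Type) (D : set T) (F : set (set T))
    (K : set U) (A : U -> set T) : sigma_algebra D F -> countable K ->
  (forall k, K k -> F (A k)) -> F (\bigcup_(k in K) A k).
Proof.
move=> [F0 _ FU] /countable_injP[e einj] FA.
rewrite (_ : \bigcup_(k in K) A k =
    \bigcup_n \bigcup_(k in K `&` [set k | e k = n]) A k); last first.
  apply/seteqP; split => [t [k Kk Ak]|t [n _ [k [Kk _] Ak]]]; last by exists k.
  by exists (e k) => //; exists k.
apply: FU => n.
have [->|/set0P[k0 [Kk0 ek0]]] := eqVneq (K `&` [set k | e k = n]) set0.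
  by rewrite bigcup_set0.
rewrite (_ : _ `&` _ = [set k0]) ?bigcup_set1; first exact: FA.
apply/seteqP; split => [k [Kk ek]|_ ->]//.
by apply: einj; rewrite ?inE// ek -ek0.
Qed.

Lemma prob_setU (R : realType) (T : Type) (M : prob_space R T) A B :
  events M A -> events M B -> A `&` B = set0 ->
  (prob M (A `|` B) = prob M A + prob M B)%E.
Proof.
move=> eA eB AB0; have [e0 _ _] := events_sigma_algebra M.
have eAB n : events M (bigcup2 A B n) by case: n => [|[|n]].
rewrite -bigcup2E prob_sigma_additive//; last by rewrite -trivIset_bigcup2.
rewrite (nneseries_split 0%N 2%N); last by move=> n _; exact: prob_ge0.
rewrite eseries0 ?adde0; first by rewrite add0n !big_nat_recl//= big_geq// adde0.
by move=> [|[|n]]//= _ _; exact: prob_set0.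
Qed.

(** Dynkin's argument: the events on which both measures agree form a lambda-system containing the
    pi-system [C]. *)
Lemma eq_prob_space (R : realType) (T : Type) (M M' : prob_space R T)
    (C : set (set T)) : setI_closed C ->
  sample_space M = sample_space M' -> events M = events M' ->
  events M = <<s sample_space M, C >> ->
  (forall A, C A -> prob M A = prob M' A) ->
  forall A, events M A -> prob M A = prob M' A.
Proof.
move=> CI eD eE eC eP.
have sM := events_sigma_algebra M.
have [E0 ED EU] := sM.
have E_sub A : events M A -> A `<=` sample_space M by exact: events_sub.
have [ET ESD END _] := (sigma_algebraP E_sub).1 sM.
(* Finiteness permits the cancellation in [SD]; it holds because an event and its complement have
   nonnegative measures with sum 1. *)
have fin A : events M A -> prob M A \is a fin_num.
  move=> eA; have := prob_setU eA (ED _ eA) (setDIK _ _).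
  rewrite setDUK ?prob_sample_space; last exact: E_sub.
  have := prob_ge0 eA; have := prob_ge0 (ED _ eA).
  by case: (prob M A) => // ; case: (prob M _).
suff : <<s sample_space M, C >> `<=` [set A | events M A /\ prob M A = prob M' A].
  by move=> h A; rewrite eC => /h[].
apply: lambda_system_subset => //; last 2 first.
- by move=> A CA; split; [rewrite eC; exact: sub_sigma_algebra|exact: eP].
- by rewrite -eC.
have SD : setSD_closed [set A | events M A /\ prob M A = prob M' A].
  move=> B A AB [eB pB] [eA pA]; have eBA := ESD _ _ AB eB eA.
  split => //; have := prob_setU eA eBA (setDIK _ _).
  rewrite setDUK// pB pA; have := @prob_setU R T M' A (B `\` A).
  rewrite -eE setDUK// => -> //; last exact: setDIK.
  rewrite -pA; have := fin _ eA; case: (prob M A) => // a _.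
  case: (prob M' _) => [x||]; case: (prob M _) => [y||]//= [].
  by move=> /addrI ->.
split => //; first by move=> A [/E_sub].
  by split; rewrite // eD !prob_sample_space // -eD prob_sample_space.
move=> F ndF hF; split; first by apply: EU => n; have [] := hF n.
(* The increasing union is rewritten as a disjoint union of successive differences, to which
   countable additivity applies. *)
have hD n : events M (seqD F n) /\ prob M (seqD F n) = prob M' (seqD F n).
  case: n => [|n]; first exact: hF.
  apply: SD; [|exact: hF|exact: hF].
  by apply/subsetPset; apply: ndF; rewrite leqnSn.
rewrite -eq_bigcup_seqD !prob_sigma_additive//; last 4 first.
- by move=> n; rewrite -eE; have [] := hD n.
- exact: trivIset_seqD.
- by move=> n; have [] := hD n.
- exact: trivIset_seqD.
by apply: eq_eseriesr => n _; have [] := hD n.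
Qed.

Section OutcomeSpace.
Context (R : realType) (S : Type) (ar : S -> nat) (Delta : set (pdist R)).
Context (G : program ar Delta) (I : set (fact (xsym S R) R)).
Hypothesis hI : input_instance G I.

Notation xfact := (fact (xsym S R) R).
Notation Omega := (possible_outcomes G I).

Definition is_distr (f : xfact) : bool :=
  if Defs.fsym f is Distr _ _ _ then true else false.

Definition sample_key (f : xfact) : xfact :=
  Fact (Defs.fsym f) (if Defs.fsym f is Distr _ _ i
    then take i (fargs f) ++ 0 :: drop i.+1 (fargs f) else fargs f).

Lemma sample_key_dfact r d a y b :
  sample_key (dfact r d a y b) = dfact r d a 0 b.
Proof.
rewrite /sample_key /= take_size_cat//; congr (Fact _ (_ ++ _ :: _)).
by rewrite -cat_rcons drop_size_cat// size_rcons.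
Qed.

Lemma derivation_distr s f : derivation G I s -> f \in s -> is_distr f ->
  exists r d a y b, [/\ f = dfact r d a y b, universe G I (dfact r d a 0 b),
    key_supp (dfact r d a 0 b) y & weight ar f = key_dist ar (dfact r d a 0 b) y].
Proof.
move=> hs fs; have [[r e]|] := derivation_sampled hs fs; first by rewrite /is_distr e.
by move=> [r [d [a [y [b [? ? ? ?]]]]]] _; exists r, d, a, y, b.
Qed.

Lemma PF_seq (s : seq xfact) : uniq s -> PF ar [set` s] = \prod_(f <- s) weight ar f.
Proof. by move=> us; rewrite /PF -fsbig_seq. Qed.

(** By [derivation_sub_chase] the event prescribes the values of finitely many keys, so independence
    gives a product over keys. It equals [PF] because the remaining facts have weight 1. *)
Lemma derivation_event (Y : R -> xfact -> R) :
  (forall (s : seq xfact) (o : xfact -> R), uniq s ->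
    (forall k, k \in s -> universe G I k /\ key_supp k (o k)) ->
    let E := `[0, 1[%classic `&` [set x | forall k, k \in s -> Y x k = o k] in
    measurable E /\ lebesgue_measure E = (\prod_(k <- s) key_dist ar k (o k))%:E) ->
  forall s, derivation G I s ->
  let E := `[0, 1[%classic `&` [set x | [set` s] `<=` chase G I (Y x)] in
  measurable E /\ lebesgue_measure E = (PF ar [set` s])%:E.
Proof.
move=> hY s hs E.
pose ks := [seq sample_key f | f <- s & is_distr f].
have mem_ks k : k \in ks -> exists r d a y b,
    [/\ k = dfact r d a 0 b, dfact r d a y b \in s, universe G I k & key_supp k y].
  move=> /mapP[f]; rewrite mem_filter => /andP[df fs] ->.
  have [r [d [a [y [b [ef ? ? _]]]]]] := derivation_distr hs fs df.
  by exists r, d, a, y, b; rewrite ef sample_key_dfact -ef.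
(* Two facts with the same key would differ only in the sampled value, which [derivation_functional]
   excludes. *)
have uks : uniq ks.
  rewrite map_inj_in_uniq; first exact/filter_uniq/derivation_uniq/hs.
  move=> f g; rewrite !mem_filter => /andP[df fs] /andP[dg gs].
  have [r [d [a [y [b [ef _ _ _]]]]]] := derivation_distr hs fs df.
  have [r' [d' [a' [y' [b' [eg _ _ _]]]]]] := derivation_distr hs gs dg.
  rewrite ef eg !sample_key_dfact => e; move: ef eg fs gs.
  have [-> -> -> _ ->] := dfact_inj e => -> -> fs gs.
  by rewrite (derivation_functional hs fs gs).
have := hY ks (choice_of [set` s]) uks.
have -> : E = `[0, 1[%classic `&`
    [set x | forall k, k \in ks -> Y x k = choice_of [set` s] k].
  rewrite /E; congr (_ `&` _); apply/seteqP; split => x /=.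
    move=> /(derivation_sub_chase hI (Y x) hs) h k.
    move=> /mem_ks[r [d [a [y [b [-> ys _ _]]]]]].
    by rewrite (h _ _ _ _ _ ys) (choice_of_derivation hs ys).
  move=> h; apply/(derivation_sub_chase hI (Y x) hs) => r d a y b ys.
  rewrite h ?(choice_of_derivation hs ys)// -(sample_key_dfact r d a y b).
  by apply: map_f; rewrite mem_filter ys.
case=> [k /mem_ks[r [d [a [y [b [ek ys ? ky]]]]]]|mE ->].
  by split => //; rewrite {2}ek (choice_of_derivation hs ys).
split => //; congr EFin; rewrite PF_seq; last exact: derivation_uniq hs.
rewrite big_map big_filter [LHS]big_mkcond; apply: eq_big_seq => f fs.
case: ifP => df.
  have [r [d [a [y [b [ef _ _ ->]]]]]] := derivation_distr hs fs df.
  by rewrite ef sample_key_dfact (choice_of_derivation hs (y := y))// -ef.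
by move: df; rewrite /is_distr /weight; case: (Defs.fsym f).
Qed.

Lemma outcome_chase J : Omega J -> exists c, J = chase G I c.
Proof. by move=> [/(minimal_solution_chase hI) -> _]; eexists. Qed.

Lemma outcome_cover J (F : set xfact) : Omega J -> finite_set F -> F `<=` J ->
  exists s, [/\ derivation G I s, [set` s] `<=` J & F `<=` I `|` [set` s]].
Proof.
move=> OJ /finite_seqP[l ->] FJ; have [c eJ] := outcome_chase OJ; subst J.
by apply: (derivation_cover hI) => f /FJ; exact: chase_derivation.
Qed.

Lemma outcomes_withU F F' : outcomes_with G I F `&` outcomes_with G I F' =
  outcomes_with G I (F `|` F').
Proof.
apply/seteqP; split => [J [[OJ FJ] [_ F'J]]|J [OJ]].
  by split => //; rewrite subUset.
by rewrite subUset => -[? ?]; split; split.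
Qed.

(** The empty set is added since two derivation sets, for instance with different values for one
    event, may have no common outcome. *)
Definition derivation_generators : set (set (set xfact)) := [set A |
  A = set0 \/ exists2 F, derivation_set G I F & A = outcomes_with G I F].

Lemma derivation_generators_setI : setI_closed derivation_generators.
Proof.
move=> A B [->|[_ [s hs ->] ->]]; first by rewrite set0I; left.
move=> [->|[_ [s' hs' ->] ->]]; first by rewrite setI0; left.
rewrite outcomes_withU.
have [->|/set0P[J [OJ]]] := eqVneq (outcomes_with G I ([set` s] `|` [set` s'])) set0.
  by left.
have [c ->] := outcome_chase OJ; rewrite subUset => -[sc s'c].
have [s2 hs2 <-] := derivationU hI hs hs' sc s'c.
by right; exists [set` s2] => //; exists s2.
Qed.

(** Finitely many facts of an outcome need only finitely many derivation steps beyond the input, and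
    every outcome contains the input. *)
Lemma outcomes_with_bigcup F : finite_set F -> outcomes_with G I F =
  \bigcup_(D in [set D | derivation_set G I D /\ F `<=` I `|` D]) outcomes_with G I D.
Proof.
move=> finF; apply/seteqP; split => [J [OJ FJ]|J [D [_ FD] [OJ DJ]]].
  have [s [hs sJ Fs]] := outcome_cover OJ finF FJ.
  by exists [set` s] => //; split => //; exists s.
split => //; apply: (subset_trans FD); rewrite subUset; split => //.
by have [[[_ ? _] _] _] := OJ.
Qed.

Lemma derivation_sets_countable : countable [set D | derivation_set G I D].
Proof.
apply: (sub_countable _ (countable_finite_subset (universe_countable hI))).
apply: subset_card_le => _ [s hs ->]; split; last exact: finite_seq.
exact: derivation_universe.
Qed.

Lemma events_derivation :
  <<s Omega, outcome_generators G I >> = <<s Omega, derivation_generators >>.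
Proof.
apply/seteqP; split; apply: smallest_sub; try exact: smallest_sigma_algebra.
  move=> _ [F [finF _ ->]]; rewrite outcomes_with_bigcup//.
  apply: (sigma_algebra_countable_bigcup (smallest_sigma_algebra _ _)).
    apply: (sub_countable _ derivation_sets_countable).
    by apply: subset_card_le => D [].
  by move=> D [hD _]; apply: sub_sigma_algebra; right; exists D.
move=> A [->|[_ [s hs ->] ->]].
  by have [] := smallest_sigma_algebra Omega (outcome_generators G I).
apply: sub_sigma_algebra; exists [set` s]; split => //.
by move=> f fs; exact: (derivation_over hs fs).
Qed.

(** A derivation inside [J] covers it, so [J] is the input together with [s]. An outcome containing
    [s] then contains the solution [J] and equals it by minimality. Input facts have weight 1. *)
Lemma finite_outcome J : Omega J -> finite_set J ->
  exists s, [/\ derivation G I s, [set J] = outcomes_with G I [set` s]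
    & PF ar J = PF ar [set` s]].
Proof.
move=> OJ finJ; have [s [hs sJ Js]] := outcome_cover OJ finJ (@subset_refl _ J).
have [[sol minJ] _] := OJ; have [_ IJ _] := sol.
have eJ : J = I `|` [set` s] by apply/seteqP; split => //; rewrite subUset.
exists s; split => //.
  apply/seteqP; split => [_ ->//|J' [[[[_ IJ' _] min'] _] sJ']].
  have JJ' : J `<=` J' by rewrite eJ subUset.
  apply/seteqP; split => //; apply: contrapT => nJ.
  exact: (min' J sol).
rewrite /PF; apply/esym/fsbig_widen => // f [Jf nf] /=.
have [If|//] := Js _ Jf; have [r e] := input_orig hI If.
by rewrite /weight e.
Qed.

End OutcomeSpace.

(** * The law of the random chase, its existence and uniqueness *)

Lemma g_sigma_algebra_sub (T : Type) (D : set T) (C : set (set T)) :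
  (forall A, C A -> A `<=` D) -> forall A, <<s D, C >> A -> A `<=` D.
Proof.
move=> CD; apply: (@smallest_sub _ _ C [set A | A `<=` D]) => //.
by split => //= A hA; apply: bigcup_sub => n _; exact: hA.
Qed.

(** Measurability need only be checked on generators, since the sets with measurable preimage in [D]
    form a sigma-algebra over [O]. *)
Lemma pushforward_prob_space (R : realType) (T : Type) (D : set R) (O : set T)
    (C : set (set T)) (phi : R -> T) :
  measurable D -> lebesgue_measure D = 1%E -> (forall x, D x -> O (phi x)) ->
  (forall A, C A -> A `<=` O) -> (forall A, C A -> measurable (D `&` phi @^-1` A)) ->
  exists M : prob_space R T, [/\ sample_space M = O, events M = <<s O, C >>
    & forall A, prob M A = lebesgue_measure (D `&` phi @^-1` A)].
Proof.
move=> mD muD DO CO mC.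
have mE A : <<s O, C >> A -> measurable (D `&` phi @^-1` A).
  apply: (@smallest_sub _ _ C [set A | measurable (D `&` phi @^-1` A)]) => //.
  split => /= [|B mB|B mB]; first by rewrite preimage_set0 setI0.
    rewrite (_ : _ `&` _ = D `\` (D `&` phi @^-1` B)); first exact: measurableD.
    apply/seteqP; split => x [Dx].
      by move=> [_ nB]; split => // -[].
    by move=> nB; split => //; split; [exact: DO|move=> Bx; apply: nB].
  by rewrite preimage_bigcup setI_bigcupr; exact: bigcup_measurable.
pose P A := lebesgue_measure (D `&` phi @^-1` A).
have P0 A : <<s O, C >> A -> (0 <= P A)%E by [].
have Pset0 : P set0 = 0%E by rewrite /P preimage_set0 setI0 measure0.
have P1 : P O = 1%E by rewrite /P (_ : _ `&` _ = D)//; exact/setIidPl.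
have PU (A : nat -> set T) : (forall n, <<s O, C >> (A n)) -> trivIset setT A ->
    P (\bigcup_n A n) = (\sum_(0 <= n <oo) P (A n))%E.
  move=> eA tA; rewrite /P preimage_bigcup setI_bigcupr measure_semi_bigcup//.
  - by move=> n; exact: mE.
  - by move=> i j _ _ [x [[_ xi] [_ xj]]]; apply: tA => //; exists (phi x).
  - by apply: bigcup_measurable => n _; exact: mE.
by exists (ProbSpace (smallest_sigma_algebra O C) (g_sigma_algebra_sub CO)
  P0 Pset0 P1 PU).
Qed.

Unset Implicit Arguments.

Theorem theorem5p2 (R : realType) (S : Type) (ar : S -> nat)
    (Delta : set (pdist R)) (finDelta : finite_set Delta)
    (G : program ar Delta) (I : set (fact (xsym S R) R))
    (hI : input_instance G I) :
  let is_mu (M : prob_space R (set (fact (xsym S R) R))) :=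
    [/\ sample_space M = possible_outcomes G I,
        events M = <<s possible_outcomes G I, outcome_generators G I >>
      & forall F, derivation_set G I F ->
          prob M (outcomes_with G I F) = (PF ar F)%:E] in
  exists M : prob_space R (set (fact (xsym S R) R)),
    [/\ is_mu M,
        forall M', is_mu M' -> same_prob_space M' M
      & forall J, possible_outcomes G I J -> finite_set J ->
          events M [set J] /\ prob M [set J] = (PF ar J)%:E].
Proof.
move=> is_mu.
have [Y [Ypos Yind]] := @independent_samples R (fact (xsym S R) R) R
  (universe G I) _ _ 0 (universe_countable hI) (@key_supp_countable R S)
  (@key_dist_ge0 R S ar) (@key_dist_sum1 R S ar).
(* Positivity of the draws at every point makes the chase an outcome everywhere, so no null set has
   to be removed. *)
have phiO x : `[0, 1[%classic x -> possible_outcomes G I (chase G I (Y x)).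
  by move=> x01; apply: chase_outcome => // k Kk; have [] := Ypos x k x01 Kk.
have ev s : derivation G I s ->
    let E := `[0, 1[%classic `&`
      (fun x => chase G I (Y x)) @^-1` outcomes_with G I [set` s] in
    measurable E /\ lebesgue_measure E = (PF ar [set` s])%:E.
  move=> hs E; rewrite /E (_ : _ `&` _ =
    `[0, 1[%classic `&` [set x | [set` s] `<=` chase G I (Y x)]).
    exact: (derivation_event hI Yind hs).
  apply/seteqP; split => x [x01]; first by move=> [_ h]; split.
  by move=> h; split => //; split => //; exact: phiO.
have genO A : derivation_generators G I A -> A `<=` possible_outcomes G I.
  by move=> [->//|[F _ ->] J []].
(* The pushforward is taken over the pi-system, where [ev] gives measurability; [events_derivation]
   identifies the sigma-algebra with the required one. *)
have [|||M [sM eM pM]] :=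
    @pushforward_prob_space R _ `[0, 1[%classic _ _ _ _ _ phiO genO.
- exact: measurable_itv.
- by rewrite lebesgue_measure_itv /= lte_fin ltr01 sube0.
- move=> A [->|[_ [s hs ->] ->]]; first by rewrite preimage_set0 setI0.
  exact: (ev s hs).1.
have muM : is_mu M.
  split => //; first by rewrite eM events_derivation.
  by move=> _ [s hs ->]; rewrite pM; exact: (ev s hs).2.
exists M; split => //.
- move=> M' [sM' eM' pM']; split; [by rewrite sM|by rewrite eM eM' events_derivation|].
  apply: (@eq_prob_space _ _ _ _ (derivation_generators G I)).
  + exact: derivation_generators_setI.
  + by rewrite sM.
  + by rewrite eM eM' events_derivation.
  + by rewrite eM' sM' events_derivation.
  + move=> A [->|[F hF ->]]; first by rewrite !prob_set0.
    by rewrite pM'//; case: muM => _ _ ->.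
- move=> J OJ finJ; have [s [hs -> ->]] := finite_outcome hI OJ finJ; split.
    by rewrite eM; apply: sub_sigma_algebra; right; exists [set` s] => //; exists s.
  by case: muM => _ _; apply; exists s.
Qed.
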